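(* Let $T$ be a complete first-order theory, $n<\omega$, let $a_0,\dots,a_{n-1}$ be tuples in the monster model of $T$ and let $k_0,\dots,k_{n-1}\in\omega$. If $\operatorname{bdn}(a_i)<k_i$ for all $i<n$, then $\operatorname{bdn}(a_0\dots a_{n-1})<\prod_{i<n}k_i$.
   Context: We work in a monster model of a complete first-order theory $T$; no assumption is made on $T$. A set of formulas is $k$-inconsistent if every subset of $k$ of its members (with distinct indices) is inconsistent. An inp-pattern of depth $\kappa$ in a partial type $p(x)$ consists of an array of tuples $(a_{\alpha,i})_{\alpha<\kappa,i<\omega}$, formulas $\phi_\alpha(x,y_\alpha)$ and numbers $k_\alpha<\omega$ such that: (i) $\{\phi_\alpha(x,a_{\alpha,i})\}_{i<\omega}$ is $k_\alpha$-inconsistent for each $\alpha<\kappa$; (ii) $\{\phi_\alpha(x,a_{\alpha,f(\alpha)})\}_{\alpha<\kappa}\cup p(x)$ is consistent for every $f:\kappa\to\omega$. The burden $\operatorname{bdn}(p)$ is the supremum of the depths of all inp-patterns in $p(x)$. For a tuple $a$, $\operatorname{bdn}(a/C)=\operatorname{bdn}(\operatorname{tp}(a/C))$ and $\operatorname{bdn}(a)=\operatorname{bdn}(a/\emptyset)$. *)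

(* Defs.v *)
From mathcomp Require Import all_boot.
From mathcomp Require Import boolp classical_sets functions cardinality.

Set Implicit Arguments.
Unset Strict Implicit.
Unset Printing Implicit Defensive.

Local Open Scope classical_set_scope.
Local Open Scope card_scope.

(** * Cardinals

    A cardinal is represented by any type of that cardinality. *)

Definition card_lt (A B : Type) : Prop :=
  [set: A] #<= [set: B] /\ ~ ([set: B] #<= [set: A]).

(** * First-order logic *)

Record language := Language {
  func : Type;
  func_arity : func -> nat;
  rel_sym : Type;
  rel_arity : rel_sym -> nat }.

(** Terms and formulas are indexed by the type [V] of their free variables; the
    variable bound by [All] is [None].  The remaining connectives are the usual
    classical abbreviations. *)

Inductive term (L : language) (V : Type) : Type :=
| Var of V
| App (f : func L) of 'I_(func_arity f) -> term L V.

Inductive form (L : language) (V : Type) : Type :=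
| Bot
| Eq of term L V & term L V
| Rel (r : rel_sym L) of 'I_(rel_arity r) -> term L V
| Imp of form L V & form L V
| All of form L (option V).

Arguments Bot {L V}.

Fixpoint term_map L V W (g : V -> W) (t : term L V) : term L W :=
  match t with
  | Var v => Var L (g v)
  | App _ ts => App (fun j => term_map g (ts j))
  end.

Fixpoint form_map L V W (g : V -> W) (phi : form L V) : form L W :=
  match phi with
  | Bot => Bot
  | Eq s t => Eq (term_map g s) (term_map g t)
  | Rel _ ts => Rel (fun j => term_map g (ts j))
  | Imp psi chi => Imp (form_map g psi) (form_map g chi)
  | All psi => All (form_map (omap g) psi)
  end.

Record structure (L : language) := Structure {
  carrier :> Type;
  carrier_inhabited : inhabited carrier;
  func_interp : forall f : func L, ('I_(func_arity f) -> carrier) -> carrier;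
  rel_interp : forall r : rel_sym L, ('I_(rel_arity r) -> carrier) -> Prop }.

Fixpoint eval L (M : structure L) V (v : V -> M) (t : term L V) : M :=
  match t with
  | Var x => v x
  | App _ ts => func_interp (fun j => eval v (ts j))
  end.

Fixpoint sat L (M : structure L) V (v : V -> M) (phi : form L V) : Prop :=
  match phi with
  | Bot => False
  | Eq s t => eval v s = eval v t
  | Rel _ ts => rel_interp (fun j => eval v (ts j))
  | Imp psi chi => sat v psi -> sat v chi
  | All psi => forall m : M, sat (oapp v m) psi
  end.

Definition sentence (L : language) := form L void.

Definition holds L (M : structure L) (phi : sentence L) : Prop :=
  sat (M := M) (@of_void M) phi.

Definition models L (M : structure L) (T : set (sentence L)) : Prop :=
  forall phi, T phi -> holds M phi.

Definition complete_theory L (T : set (sentence L)) : Prop :=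
  (exists M : structure L, models M T) /\
  (forall phi, (forall M : structure L, models M T -> holds M phi) \/
               (forall M : structure L, models M T -> ~ holds M phi)).

Definition elementary L (M N : structure L) (h : M -> N) : Prop :=
  forall (V : Type) (phi : form L V) (v : V -> M),
    sat v phi <-> sat (h \o v) phi.

Definition automorphism L (M : structure L) (s : M -> M) : Prop :=
  [/\ bijective s,
      forall (f : func L) (u : 'I_(func_arity f) -> M),
        s (func_interp u) = func_interp (s \o u)
    & forall (r : rel_sym L) (u : 'I_(rel_arity r) -> M),
        rel_interp u <-> rel_interp (s \o u)].

(** * Formulas with parameters

    An L(M)-formula in a tuple of variables [x = (x_i)_{i : I}] is a formula
    whose free variables are in [I + M], an element [m : M] standing for its own
    name. *)

Definition pform L (M : structure L) (I : Type) := form L (I + M).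

Definition psat L (M : structure L) I (b : I -> M) (phi : pform M I) : Prop :=
  sat (fun z => match z with inl i => b i | inr m => m end) phi.

(** The formula [phi(x, a)]. *)
Definition inst L (M : structure L) I J (a : J -> M) (phi : form L (I + J)) :
    pform M I :=
  form_map (fun z => match z with inl i => inl i | inr j => inr (a j) end) phi.

(** [S] has a realization in an elementary extension [h : M -> N], i.e. its
    union with the elementary diagram of [M] has a model. *)
Definition consistent L (M : structure L) I (S : set (pform M I)) : Prop :=
  exists (N : structure L) (h : M -> N) (b : I -> N),
    elementary h /\
    forall phi, S phi ->
      sat (fun z => match z with inl i => b i | inr m => h m end) phi.

Definition over L (M : structure L) I (C : set M) : set (pform M I) :=
  [set psi | exists phi : form L (I + {c | C c}),
               psi = inst (fun c => sval c) phi].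

Definition tp L (M : structure L) I (a : I -> M) (C : set M) :
    set (pform M I) :=
  [set phi | over C phi /\ psat a phi].

(** * Monster models

    As usual, a set of formulas over [A] counts as a 1-type over [A] in [M] when
    it is finitely satisfiable in [M]. *)

Definition finitely_satisfiable L (M : structure L) I (S : set (pform M I)) :
    Prop :=
  forall (n : nat) (phi : 'I_n -> pform M I), (forall j, S (phi j)) ->
    exists b : I -> M, forall j, psat b (phi j).

Definition saturated L (M : structure L) (K : Type) : Prop :=
  forall A : set M, card_lt {m | A m} K ->
  forall S : set (pform M unit),
    S `<=` over A -> finitely_satisfiable S ->
    exists b : unit -> M, forall phi, S phi -> psat b phi.

Definition strongly_homogeneous L (M : structure L) (K : Type) : Prop :=
  forall (I : Type) (a b : I -> M), card_lt I K ->
    (forall phi : form L I, sat a phi <-> sat b phi) ->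
    exists s : M -> M, automorphism s /\ forall i, s (a i) = b i.

(** The first clause says that [K] is larger than |T| = |L| + aleph_0. *)
Definition monster L (M : structure L) (K : Type) : Prop :=
  [/\ card_lt (form L nat) K, saturated M K & strongly_homogeneous M K].

(** * Burden *)

Definition k_inconsistent L (M : structure L) I (k : nat)
    (phi : nat -> pform M I) : Prop :=
  forall s : 'I_k -> nat, injective s ->
    ~ consistent [set psi | exists j, psi = phi (s j)].

(** Inp-patterns in [p(x)] whose depth is the cardinality of [D]. *)
Record inp_pattern L (M : structure L) I (p : set (pform M I)) (D : Type) := {
  ysize : D -> nat;
  array : forall d : D, nat -> 'I_(ysize d) -> M;
  fml : forall d : D, form L (I + 'I_(ysize d));
  knum : D -> nat;
  row_inconsistent :
    forall d, k_inconsistent (knum d) (fun i => inst (@array d i) (@fml d));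
  path_consistent :
    forall f : D -> nat,
      consistent ([set psi | exists d, psi = inst (@array d (f d)) (@fml d)]
                  `|` p) }.

(** [is_bdn p B]: the supremum of the depths of all inp-patterns in [p] is the
    cardinality of [B]. *)
Definition is_bdn L (M : structure L) I (p : set (pform M I)) (B : Type) :
    Prop :=
  (forall D : Type, inhabited (inp_pattern p D) -> [set: D] #<= [set: B]) /\
  (forall B' : Type,
     (forall D : Type, inhabited (inp_pattern p D) -> [set: D] #<= [set: B']) ->
     [set: B] #<= [set: B']).

(** bdn(p) < k.  If the depths are unbounded (bdn(p) = oo) no [B] exists and
    this is false. *)
Definition bdn_lt L (M : structure L) I (p : set (pform M I)) (k : nat) :
    Prop :=
  exists B : Type, is_bdn p B /\ card_lt B 'I_k.

Definition concat (n : nat) (I : 'I_n -> Type) (X : Type)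
    (a : forall i, I i -> X) : {i : 'I_n & I i} -> X :=
  fun z => a (projT1 z) (projT2 z).

(* Main.v *)
Require Import Defs.
From mathcomp Require Import all_boot.
From mathcomp Require Import boolp classical_sets functions cardinality filter.

(** A finite bound bdn(p) < k says that [p] has no inp-pattern of depth k
    ([no_inp_pattern_of_bdn_lt], [bdn_lt_of_no_inp_pattern]), so by induction on
    the number of tuples everything reduces to two of them
    ([inp_pattern_product]): an inp-pattern of depth [A * B] in tp(a1 a2)
    produces one of depth [B] in tp(a2) or one of depth [A] in tp(a1).

    To see this, make the rows of the array mutually indiscernible
    ([indiscernible_pattern]) and treat the blocks {x} * B one after the other.
    In each block we look for a row (x, g x) such that, for every N, a single b2
    tolerates all choices of entries among the first N of the rows chosen so
    far: each choice has some b1 such that (b1, b2) satisfies the formulas of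
    the chosen entries, together with those of one fixed entry of every row of
    the blocks still to come.  Suppose that no row of block x can be added.
    Then the formulas `x2 tolerates the previous choices, with entry n of row
    (x, y) as the fixed entry', for y in B, form an inp-pattern in tp(a2): a row
    is inconsistent because an x2 accepting N + 1 of its entries would, by
    indiscernibility, allow row (x, y) to be chosen, and a path is consistent
    because indiscernibility moves the fixed entry of each row of block x
    independently.  If instead the choice succeeds in all blocks, then b2 can be
    turned into a parameter, and the formulas of the chosen rows form an
    inp-pattern of depth [A] in tp(a1).

    Both patterns are only obtained up to finite approximation: the array may
    depend on the number of columns and on the formula of the type to be
    satisfied.  [inp_pattern_of_approx] makes this sufficient.  It rests on
    [realize], the saturation of the monster model for types in countably many
    variables, and on homogeneity.  Mutually indiscernible arrays come from
    [indiscernible_array]: truth in the limit array is defined by iterating the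
    quantifier `for almost all n' of a nonprincipal ultrafilter on [nat] over
    the cells of the array, and [realize] provides an array with these truths.

    Types are handled through definable predicates on tuples of [M] rather than
    through formulas. *)

Set Implicit Arguments.
Unset Strict Implicit.
Unset Printing Implicit Defensive.

Local Open Scope classical_set_scope.
Local Open Scope card_scope.

(** * Formulas, finite supports and quantification over tuples *)

Definition vcat (X I V : Type) (b : I -> X) (v : V -> X) (z : I + V) : X :=
  match z with inl i => b i | inr x => v x end.

Lemma comp_vcat (X Y I V : Type) (h : X -> Y) (b : I -> X) (v : V -> X) :
  h \o vcat b v = vcat (h \o b) (h \o v).
Proof. by apply: funext => -[]. Qed.

Lemma eval_map (L : language) (M : structure L) (V W : Type) (g : V -> W)
    (v : W -> M) (t : term L V) :
  eval v (term_map g t) = eval (v \o g) t.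
Proof. by elim: t => //= f ts IH; congr func_interp; apply: funext. Qed.

Lemma sat_map (L : language) (M : structure L) (V W : Type) (g : V -> W)
    (v : W -> M) (phi : form L V) :
  sat v (form_map g phi) <-> sat (v \o g) phi.
Proof.
elim: phi W g v => {V} [V|V s t|V r ts|V p IHp q IHq|V p IH] W g v //=.
- by rewrite !eval_map.
- by rewrite (_ : (fun j => eval v _) = fun j => eval (v \o g) (ts j)) //;
    apply: funext => j; rewrite eval_map.
- by rewrite IHp IHq.
- suff E m : oapp v m \o omap g = oapp (v \o g) m.
    by split=> H m; move: (H m); rewrite IH E.
  by apply: funext => -[].
Qed.

Definition Not (L : language) (V : Type) (phi : form L V) := Imp phi Bot.
Definition And (L : language) (V : Type) (phi psi : form L V) :=
  Not (Imp phi (Not psi)).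
Definition Ex (L : language) (V : Type) (phi : form L (option V)) :=
  Not (All (Not phi)).

Lemma sat_And (L : language) (M : structure L) (V : Type) (v : V -> M)
    (phi psi : form L V) :
  sat v (And phi psi) <-> sat v phi /\ sat v psi.
Proof.
split=> /= [H|[H1 H2] H]; last exact: H.
by split; apply: contrapT => N; apply: H.
Qed.

Lemma sat_Ex (L : language) (M : structure L) (V : Type) (v : V -> M)
    (phi : form L (option V)) :
  sat v (Ex phi) <-> exists m, sat (oapp v m) phi.
Proof.
split=> /= [H|[m H] H']; last exact: H' H.
by apply: contrapT => N; apply: H => m Hm; apply: N; exists m.
Qed.

(** Only membership in the list of variables matters, so [V] gets a classical
    decidable equality. *)
Fixpoint term_vars (L : language) (V : Type) (t : term L V) : seq {classic V} :=
  match t with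
  | Var x => [:: x]
  | App _ ts => flatten (codom (fun j => term_vars (ts j)))
  end.

Fixpoint vars (L : language) (V : Type) (phi : form L V) : seq {classic V} :=
  match phi with
  | Bot => [::]
  | Eq s t => term_vars s ++ term_vars t
  | Rel _ ts => flatten (codom (fun j => term_vars (ts j)))
  | Imp p q => vars p ++ vars q
  | All p => pmap id (vars p : seq (option {classic V}))
  end.

Lemma eval_vars (L : language) (M : structure L) (V : Type) (t : term L V)
    (v w : V -> M) :
  (forall x, x \in term_vars t -> v x = w x) -> eval v t = eval w t.
Proof.
elim: t => [x|f ts IH] /= H; first by apply: H; rewrite inE.
congr func_interp; apply: funext => j; apply: IH => x xj.
by apply: H; apply/flattenP; exists (term_vars (ts j)) => //; exact: codom_f.
Qed.

Lemma mem_classic_pmap (V W : Type) (f : W -> option V) (z : W) (x : V)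
    (s : seq {classic W}) :
  f z = Some x -> (z : {classic W}) \in s ->
  (x : {classic V}) \in (pmap f s : seq {classic V}).
Proof.
move=> fz; elim: s => //= y s IH; rewrite in_cons => /orP[/eqP <-|/IH xs].
  by rewrite fz; exact: mem_head.
by case: (f y) => //= w; rewrite in_cons xs orbT.
Qed.

Lemma sat_vars (L : language) (M : structure L) (V : Type) (phi : form L V)
    (v w : V -> M) :
  (forall x, x \in vars phi -> v x = w x) -> sat v phi <-> sat w phi.
Proof.
elim: phi v w => {V} [V|V s t|V r ts|V p IHp q IHq|V p IH] v w //= H.
- rewrite (@eval_vars _ _ _ s v w) ?(@eval_vars _ _ _ t v w) // => x xs;
  by apply: H; rewrite mem_cat xs ?orbT.
- rewrite (_ : (fun j => eval v (ts j)) = fun j => eval w (ts j)) //.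
  apply: funext => j; apply: eval_vars => x xj.
  by apply: H; apply/flattenP; exists (term_vars (ts j)) => //; exact: codom_f.
- rewrite (IHp v w) ?(IHq v w) // => x xs;
  by apply: H; rewrite mem_cat xs ?orbT.
- suff E m : sat (oapp v m) p <-> sat (oapp w m) p.
    by split=> K m; apply/E.
  apply: IH => -[x|] //= xp; apply: H.
  exact: (mem_classic_pmap (f := id)) xp.
Qed.

(** Quantifying existentially over the variables in [l], one at a time: each is
    sent to [None] and bound, the type of free variables staying the same. *)
Lemma ex_form_seq (L : language) (I V : Type) (phi : form L (I + V))
    (l : seq {classic I}) :
  exists phi' : form L (I + V), forall (M : structure L) (b : I -> M) v,
    sat (vcat b v) phi' <->
    exists b' : I -> M, (forall i, i \notin l -> b' i = b i) /\
                        sat (vcat b' v) phi.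
Proof.
elim: l => [|i l [psi Hpsi]].
  exists phi => M b v; split=> [H|[b' [E]]]; first by exists b.
  by rewrite (_ : b' = b) //; apply: funext => j; exact: E.
exists (Ex (form_map (fun z : I + V => match z with
   | inl j => if (j : {classic I}) == i then None else Some (inl j)
   | inr y => Some (inr y) end) psi)) => M b v.
pose upd m (j : I) := if (j : {classic I}) == i then m else b j.
have E m : sat (oapp (vcat b v) m) (form_map (fun z : I + V => match z with
   | inl j => if (j : {classic I}) == i then None else Some (inl j)
   | inr y => Some (inr y) end) psi) <-> sat (vcat (upd m) v) psi.
  rewrite sat_map (_ : _ \o _ = vcat (upd m) v) //.
  by apply: funext => -[j|y] //=; rewrite /upd; case: eqP.
rewrite sat_Ex; split=> [[m /E /Hpsi[b' [H1 H2]]]|[b' [H1 H2]]].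
  exists b'; split=> // j; rewrite inE negb_or => /andP[ji jl].
  by rewrite H1 // /upd (negbTE ji).
exists (b' i); apply/E/Hpsi; exists b'; split=> // j jl; rewrite /upd.
by case: eqP => [->//|/eqP ji]; rewrite H1 // inE negb_or ji.
Qed.

Definition lvars (L : language) (I V : Type) (phi : form L (I + V)) :
    seq {classic I} :=
  pmap (fun z : I + V => if z is inl i then Some i else None) (vars phi).

Lemma mem_lvars (L : language) (I V : Type) (phi : form L (I + V)) (i : I) :
  (inl i : {classic I + V}) \in vars phi -> (i : {classic I}) \in lvars phi.
Proof.
exact: mem_classic_pmap.
Qed.

Lemma sat_lvars (L : language) (M : structure L) (I V : Type)
    (phi : form L (I + V)) (b b' : I -> M) (v : V -> M) :
  (forall i, i \in lvars phi -> b i = b' i) ->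
  sat (vcat b v) phi <-> sat (vcat b' v) phi.
Proof.
by move=> H; apply: sat_vars => -[i|y] //= il; apply: H; exact: mem_lvars.
Qed.

(** A formula mentions finitely many variables, hence quantification over a
    tuple of arbitrary length is first-order, by a formula that is the same for
    all structures.  The latter lets it travel along elementary maps. *)
Lemma ex_form (L : language) (I V : Type) (phi : form L (I + V)) :
  exists phi' : form L V, forall (M : structure L) (v : V -> M),
    sat v phi' <-> exists b : I -> M, sat (vcat b v) phi.
Proof.
have [psi Hpsi] := ex_form_seq phi (lvars phi).
have psiE (M : structure L) (b : I -> M) v :
    sat (vcat b v) psi <-> exists b' : I -> M, sat (vcat b' v) phi.
  rewrite Hpsi; split=> [[b' [_ H]]|[b' H]]; first by exists b'.
  exists (fun i : {classic I} => if i \in lvars phi then b' i else b i).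
  split=> [i /negbTE ->//|]; apply/sat_lvars/H => i; last by move=> ->.
(* The variables in [I] are now irrelevant but still there; [V] may be empty, so
   they are merged into one new variable, which is bound. *)
exists (Ex (form_map (fun z : I + V => match z with
   | inl _ => None | inr y => Some y end) psi)) => M v.
have E m : sat (oapp v m) (form_map (fun z : I + V => match z with
   | inl _ => None | inr y => Some y end) psi) <->
   exists b' : I -> M, sat (vcat b' v) phi.
  rewrite sat_map -(psiE _ (fun=> m)) (_ : _ \o _ = vcat (fun=> m) v) //.
  by apply: funext => -[].
rewrite sat_Ex; split=> [[m /E//]|H].
by have [m] := carrier_inhabited M; exists m; apply/E.
Qed.

(** * Definable predicates *)

Lemma forall_form (L : language) (V : Type) (F : finType)
    (phi : F -> form L V) :
  exists psi : form L V, forall (M : structure L) (v : V -> M),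
    sat v psi <-> forall j, sat v (phi j).
Proof.
suff [psi H] : exists psi : form L V, forall (M : structure L) (v : V -> M),
    sat v psi <-> forall j, j \in enum F -> sat v (phi j).
  exists psi => M v; rewrite H; split=> // K j; apply: K; exact: mem_enum.
elim: (enum F) => [|j s [psi H]].
  by exists (Not Bot) => M v; split=> _ /= j; rewrite ?in_nil.
exists (And (phi j) psi) => M v; rewrite sat_And H; split.
  by move=> [H1 H2] i; rewrite in_cons => /orP[/eqP->|/H2].
by move=> K; split=> [|i si]; apply: K; rewrite in_cons ?eqxx ?si ?orbT.
Qed.

Definition definable (L : language) (M : structure L) (V : Type)
    (P : (V -> M) -> Prop) : Prop :=
  exists phi : form L V, forall v, P v <-> sat v phi.

Definition definable2 (L : language) (M : structure L) (I Y : Type)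
    (R : (I -> M) -> (Y -> M) -> Prop) : Prop :=
  definable (fun u : I + Y -> M =>
    R (fun i => u (inl i)) (fun y => u (inr y))).

Lemma definable_sat (L : language) (M : structure L) (V : Type)
    (phi : form L V) : definable (fun v : V -> M => sat v phi).
Proof. by exists phi. Qed.

Lemma definable_comp (L : language) (M : structure L) (V W : Type) (g : V -> W)
    (P : (V -> M) -> Prop) :
  definable P -> definable (fun w : W -> M => P (fun x => w (g x))).
Proof. by move=> [phi H]; exists (form_map g phi) => w; rewrite sat_map H. Qed.

Lemma definable_rel (L : language) (M : structure L) (I Y W : Type)
    (f : I -> W) (g : Y -> W) (R : (I -> M) -> (Y -> M) -> Prop) :
  definable2 R ->
  definable (fun w : W -> M => R (fun i => w (f i)) (fun y => w (g y))).
Proof. exact: (definable_comp (vcat f g)). Qed.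

Lemma definable_eq (L : language) (M : structure L) (V : Type) (x y : V) :
  definable (fun v : V -> M => v x = v y).
Proof. by exists (Eq (Var L x) (Var L y)). Qed.

Lemma definable_not (L : language) (M : structure L) (V : Type)
    (P : (V -> M) -> Prop) : definable P -> definable (fun v => ~ P v).
Proof. by move=> [phi H]; exists (Not phi) => v; split=> N /H. Qed.

Lemma definable_and (L : language) (M : structure L) (V : Type)
    (P Q : (V -> M) -> Prop) :
  definable P -> definable Q -> definable (fun v => P v /\ Q v).
Proof.
by move=> [p Hp] [q Hq]; exists (And p q) => v; rewrite sat_And Hp Hq.
Qed.

Lemma definable_forall (L : language) (M : structure L) (V : Type) (F : finType)
    (P : F -> (V -> M) -> Prop) :
  (forall j, definable (P j)) -> definable (fun v => forall j, P j v).
Proof.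
move=> /boolp.choice[phi Hphi]; have [psi H] := forall_form phi.
by exists psi => v; rewrite H; split=> K j; apply/Hphi.
Qed.

Lemma definable_true (L : language) (M : structure L) (V : Type) :
  definable (fun _ : V -> M => True).
Proof. by exists (Not Bot) => v; split=> _ /=. Qed.

Lemma definable_imp (L : language) (M : structure L) (V : Type) (p : Prop)
    (P : (V -> M) -> Prop) :
  definable P -> definable (fun v => p -> P v).
Proof.
move=> Pdef; have [ptrue|pfalse] := EM p.
  by case: Pdef => phi H; exists phi => v; rewrite -H; split=> // K; apply: K.
by have [phi H] := definable_true M V; exists phi => v; rewrite -H; split.
Qed.

Lemma definable_ex (L : language) (M : structure L) (I V : Type)
    (R : (I -> M) -> (V -> M) -> Prop) :
  definable2 R -> definable (fun v => exists b : I -> M, R b v).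
Proof.
move=> [phi H]; have [psi Hpsi] := ex_form phi.
exists psi => v; rewrite Hpsi.
by split=> -[b Hb]; exists b; [apply/(H (vcat b v)) | apply/(H (vcat b v))].
Qed.

(** Consistency in an elementary extension descends to [M] for finitely many
    formulas, since their joint satisfiability is an existential statement about
    the parameters. *)
Lemma consistent_realized (L : language) (M : structure L) (I : Type)
    (S : set (pform M I)) (F : finType) (phi : F -> pform M I) :
  consistent S -> (forall j, S (phi j)) ->
  exists b : I -> M, forall j, psat b (phi j).
Proof.
move=> [N [h [b [Eh Hb]]]] Sphi.
have [psi Hpsi] := forall_form phi; have [chi Hchi] := ex_form psi.
have : sat h chi.
  by apply/Hchi; exists b; apply/Hpsi => j; exact: Hb.
rewrite -[h]/(h \o id) -Eh => /Hchi[b' /Hpsi Hb'].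
by exists b'.
Qed.

(** * Saturation in countably many variables *)

Lemma inj_card_le_setT (X Y : Type) (f : X -> Y) :
  injective f -> [set: X] #<= [set: Y].
Proof.
move=> f_inj; have : $|{injfun [set: X] >-> [set: Y]}|.
  by apply/injfunPex; exists f => // x y _ _; exact: f_inj.
by case=> g; exact: inj_card_le.
Qed.

Lemma card_le_setT_inj (X Y : Type) :
  [set: X] #<= [set: Y] -> exists f : X -> Y, injective f.
Proof.
move=> /card_leP[f].
exists (fun x => val (f (SigSub (mem_setT x)))) => x y /val_inj.
by move=> /(@inj _ _ _ f); rewrite !inE => /(_ Logic.I Logic.I) /(congr1 val).
Qed.

Lemma countable_card_lt (L : language) (M : structure L) (K X : Type)
    (f : X -> nat) : monster M K -> injective f -> card_lt X K.
Proof.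
move=> [[leLK nleKL] _ _] f_inj.
have leXL : [set: X] #<= [set: form L nat].
  apply: (@inj_card_le_setT _ _ (fun x => Eq (Var L (f x)) (Var L (f x)))).
  by move=> x y [/f_inj].
split; first exact: card_le_trans leXL leLK.
by move=> leKX; apply: nleKL; exact: card_le_trans leKX leXL.
Qed.

Lemma vars_bounded (L : language) (phi : form L nat) :
  exists n, forall x, x \in vars phi -> x < n.
Proof.
elim: (vars phi) => [|y s [n H]]; first by exists 0.
exists (maxn n y.+1) => x; rewrite in_cons leq_max => /orP[/eqP ->|/H ->//].
by rewrite ltnSn orbT.
Qed.

Lemma psat_inst (L : language) (M : structure L) (I J : Type) (a : J -> M)
    (b : I -> M) (phi : form L (I + J)) :
  psat b (inst a phi) <-> sat (vcat b a) phi.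
Proof.
rewrite /psat /inst sat_map.
by rewrite (_ : _ \o _ = vcat b a) //; apply: funext => -[].
Qed.

Definition upd_from (X : Type) (n : nat) (v : nat -> X) (m : X) (j : nat) : X :=
  if j < n then v j else m.

(** The invariant carried from [n] to [n.+1] is that each predicate in [S] has a
    solution extending the first [n] values of [v].  The next value realizes the
    1-type over these [n] values saying that it keeps every [P] solvable;
    closure of [S] under conjunction makes this type finitely satisfiable. *)
Lemma realize_step (L : language) (M : structure L) (K : Type)
    (S : set ((nat -> M) -> Prop)) (n : nat) (v : nat -> M) :
  monster M K ->
  (forall P, S P -> definable P) -> S (fun _ => True) ->
  (forall P Q, S P -> S Q -> S (fun w => P w /\ Q w)) ->
  (forall P, S P -> exists w, (forall j, j < n -> w j = v j) /\ P w) ->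
  exists m, forall P, S P ->
    exists w, (forall j, j < n.+1 -> w j = upd_from n v m j) /\ P w.
Proof.
move=> monM Sdef ST SI Sn.
have SF r (P : 'I_r -> (nat -> M) -> Prop) : (forall j, S (P j)) ->
    exists2 Q, S Q & forall w, Q w -> forall j, P j w.
  move=> SP; suff [Q SQ H] : exists2 Q, S Q &
      forall w, Q w -> forall j, j \in enum 'I_r -> P j w.
    by exists Q => // w Qw j; apply: H => //; exact: mem_enum.
  elim: (enum 'I_r) => [|i s [Q SQ H]]; first by exists (fun=> True).
  exists (fun w => P i w /\ Q w); first exact: SI.
  by move=> w [Pi Qw] j; rewrite in_cons => /orP[/eqP ->|/(H _ Qw)].
pose A : set M := [set m | exists j, j < n /\ v j = m].
have /boolp.choice[f fK] (z : {m | A m}) : exists j, v j = sval z.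
  by case: z => m /= [j [_ jm]]; exists j.
have Alt : card_lt {m | A m} K.
  apply: (countable_card_lt monM (f := f)) => x y exy.
  have : sval x = sval y by rewrite -!fK exy.
  case: x y {exy} => x px [y py] /= exy; move: px py; rewrite exy => px py.
  by congr exist; exact: Prop_irrelevance.
(* An L-formula in [nat] becomes a formula over [A] in one variable: the first
   [n] variables name parameters, all the others are the new variable. *)
pose tau j : unit + {m | A m} := match sumbool_of_bool (j < n) with
  | left h => inr (exist A (v j) (ex_intro _ j (conj h erefl)))
  | right _ => inl tt end.
have tauE (b : unit -> M) : vcat b (fun z : {m | A m} => sval z) \o tau =
    upd_from n v (b tt).
  apply: funext => j; rewrite /= /tau /upd_from.
  by case: sumbool_of_bool => h /=; rewrite h.
pose ext P (u : nat -> M) := exists w : nat -> M, (forall j : 'I_n.+1, w j = u j) /\ P w.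
have ext_def P : S P -> definable (ext P).
  move=> /Sdef Pdef; apply: definable_ex; apply: definable_and.
    apply: definable_forall => j; exact: definable_eq.
  exact: (definable_comp inl).
pose S1 : set (pform M unit) := [set psi | exists (P : (nat -> M) -> Prop) phi,
  [/\ S P, forall u : nat -> M, ext P u <-> sat u phi &
      psi = inst (fun z : {m | A m} => sval z) (form_map tau phi)]].
have S1E P phi b : (forall u : nat -> M, ext P u <-> sat u phi) ->
    psat b (inst (fun z : {m | A m} => sval z) (form_map tau phi)) <->
    ext P (upd_from n v (b tt)).
  by move=> Hphi; rewrite psat_inst sat_map tauE Hphi.
have [||b Hb] := (let: And3 _ sat _ := monM in sat) A Alt S1.
- by move=> psi [P [phi [_ _ ->]]]; exists (form_map tau phi).
- move=> r psi S1psi.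
  have [P /boolp.choice[phi Hphi]] := boolp.choice S1psi.
  have [Q SQ QP] := SF r P (fun j => let: And3 SP _ _ := Hphi j in SP).
  have [w [wv Qw]] := Sn _ SQ.
  exists (fun=> w n) => j; have [_ Pphi ->] := Hphi j.
  apply/(S1E _ _ _ Pphi); exists w; split; last exact: QP.
  move=> i; rewrite /upd_from; case: ltnP => [/wv//|ni].
  by congr w; apply/eqP; rewrite eqn_leq ni -ltnS ltn_ord.
exists (b tt) => P SP; have [phi Hphi] := ext_def P SP.
have [|w [Hw Pw]] := (S1E P phi b Hphi).1; first by apply: Hb; exists P, phi.
by exists w; split=> // j jn; rewrite -(Hw (Ordinal jn)).
Qed.

(** Any [P] in [S] depends on finitely many coordinates only, on which the
    sequence built by [realize_step] agrees with a solution of [P]. *)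
Lemma realize_nat (L : language) (M : structure L) (K : Type)
    (S : set ((nat -> M) -> Prop)) :
  monster M K ->
  (forall P, S P -> definable P) -> S (fun _ => True) ->
  (forall P Q, S P -> S Q -> S (fun w => P w /\ Q w)) ->
  (forall P, S P -> exists w, P w) ->
  exists c, forall P, S P -> P c.
Proof.
move=> monM Sdef ST SI Ssat.
pose inv n (v : nat -> M) :=
  forall P, S P -> exists w, (forall j, j < n -> w j = v j) /\ P w.
have [pt] := carrier_inhabited M.
have step (nv : nat * (nat -> M)) :
    exists m, inv nv.1 nv.2 -> inv nv.1.+1 (upd_from nv.1 nv.2 m).
  have [i|] := EM (inv nv.1 nv.2); last by exists pt.
  by have [m Hm] := realize_step monM Sdef ST SI i; exists m.
have [F HF] := boolp.choice step.
pose vs := fix vs n := if n is n'.+1 then upd_from n' (vs n') (F (n', vs n'))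
                       else fun=> pt.
have vs_inv n : inv n (vs n).
  by elim: n => [P /Ssat[w Pw]|n IH]; [exists w | exact: (HF (n, vs n))].
pose c j := vs j.+1 j.
have vsE n j : j < n -> vs n j = c j.
  elim: n => // n IH; rewrite ltnS leq_eqVlt => /orP[/eqP ->//|jn].
  by rewrite -IH //= /upd_from jn.
exists c => P SP; have [phi Hphi] := Sdef _ SP.
have [n Hn] := vars_bounded phi.
have [w [wv /Hphi Pw]] := vs_inv n P SP; apply/Hphi.
by rewrite (@sat_vars _ _ _ phi c w) // => x /Hn xn; rewrite wv ?vsE.
Qed.

(** A finitely satisfiable type in countably many variables is realized in [M];
    finite satisfiability appears as closure of [S] under conjunction. *)
Lemma realize (L : language) (M : structure L) (K : Type) (V : countType)
    (S : set ((V -> M) -> Prop)) :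
  monster M K ->
  (forall P, S P -> definable P) -> S (fun _ => True) ->
  (forall P Q, S P -> S Q -> S (fun w => P w /\ Q w)) ->
  (forall P, S P -> exists w, P w) ->
  exists c, forall P, S P -> P c.
Proof.
move=> monM Sdef ST SI Ssat.
pose S' : set ((nat -> M) -> Prop) := [set Q | exists P : (V -> M) -> Prop,
  S P /\ Q = fun u => P (fun x => u (pickle x))].
have [||||c Hc] := @realize_nat L M K S' monM.
- by move=> _ [P [SP ->]]; apply: definable_comp; exact: Sdef.
- by exists (fun=> True).
- move=> _ _ [P [SP ->]] [Q [SQ ->]].
  by exists (fun w => P w /\ Q w); split=> //; exact: SI.
- move=> _ [P [/Ssat[w Pw] ->]]; have [pt] := carrier_inhabited M.
  exists (fun j => if unpickle j is Some x then w x else pt).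
  by rewrite (_ : (fun x => _) = w) //; apply: funext => x; rewrite pickleK.
exists (fun x => c (pickle x)) => P SP.
by apply: (Hc (fun u => P (fun x => u (pickle x)))); exists P.
Qed.

(** * Types and inp-patterns up to finite approximation *)

Lemma definable2_sat (L : language) (M : structure L) (I V : Type)
    (phi : form L (I + V)) :
  definable2 (fun (b : I -> M) (v : V -> M) => sat (vcat b v) phi).
Proof.
exists phi => u; rewrite (_ : vcat _ _ = u) //.
by apply: funext => -[].
Qed.

Lemma eval_automorphism (L : language) (M : structure L) (s : M -> M)
    (V : Type) (v : V -> M) (t : term L V) :
  automorphism s -> eval (s \o v) t = s (eval v t).
Proof.
move=> [_ Hf _]; elim: t => //= f ts IH.
by rewrite Hf; congr func_interp; apply: funext.
Qed.

Lemma sat_automorphism (L : language) (M : structure L) (s : M -> M)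
    (V : Type) (v : V -> M) (phi : form L V) :
  automorphism s -> sat v phi <-> sat (s \o v) phi.
Proof.
move=> aut_s; have [[s' s'K sK'] _ Hr] := aut_s.
elim: phi v => {V} [V|V t u|V r ts|V p IHp q IHq|V p IH] v //=.
- by rewrite !eval_automorphism //; split=> [->//|/(can_inj s'K)].
- rewrite Hr (_ : (fun j => eval (s \o v) _) = s \o fun j => eval v (ts j)) //.
  by apply: funext => j; rewrite eval_automorphism.
- by rewrite IHp IHq.
- have E m : s \o oapp v m = oapp (s \o v) (s m) by apply: funext => -[].
  split=> H m; last by rewrite IH E; exact: H.
  by rewrite -(sK' m) -E -IH.
Qed.

Lemma homogeneous (L : language) (M : structure L) (K : Type) (X : countType)
    (a b : X -> M) :
  monster M K -> (forall P, definable P -> P a -> P b) ->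
  exists s, automorphism s /\ s \o a = b.
Proof.
move=> monM ab; have [_ _ hom] := monM.
have [|phi|s [aut_s sa]] := hom X a b.
- exact: countable_card_lt monM (pcan_inj pickleK).
- split; first exact: (ab _ (definable_sat M phi)).
  move=> Hb; apply: contrapT => /(ab _ (definable_not (definable_sat M phi))).
  exact.
- by exists s; split=> //; apply: funext => x /=.
Qed.

(** The tuple [a] may be uncountable, but [R] sees only a finite part [X] of it.
    First realize in [M] a copy of that finite part together with a copy of [e]
    related by [R]; then one automorphism carries the finite part of [a] to its
    copy, and a second one carries the copy of [e] to [e].  The image of [a]
    under both is the required [b]. *)
Lemma realize_over_type (L : language) (M : structure L) (K I : Type)
    (V : countType) (a : I -> M) (e : V -> M)
    (R : (I -> M) -> (V -> M) -> Prop) :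
  monster M K -> definable2 R ->
  (forall P, definable P -> P a -> exists b, P b /\ R b e) ->
  exists b, (forall phi, sat a phi <-> sat b phi) /\ R b e.
Proof.
move=> monM [phi Hphi] Hfin.
have RE b v : R b v <-> sat (vcat b v) phi := Hphi (vcat b v).
pose X : countType := seq_sub (lvars phi).
pose res (x : X) : I := ssval x.
pose R1 (u : X + V -> M) := exists b : I -> M,
  (forall x : X, b (res x) = u (inl x)) /\ R b (fun y => u (inr y)).
have R1def : definable R1.
  apply: definable_ex; apply: definable_and.
    by apply: definable_forall => x; exact: definable_eq.
  by apply: (definable_rel inl (fun y => inr (inr y))); exists phi.
pose S : set ((X + V -> M) -> Prop) := [set P | definable P /\
  exists (A : (X -> M) -> Prop) (B : (V -> M) -> Prop),
  [/\ definable A, A (a \o res), definable B, B e &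
      forall u, A (fun x => u (inl x)) -> B (fun y => u (inr y)) -> R1 u -> P u]].
have [||||u Hu] := @realize L M K _ S monM.
- by move=> P [].
- split; first exact: definable_true.
  by exists (fun=> True), (fun=> True); split=> //; exact: definable_true.
- move=> P P' [dP [A [B [dA Aa dB Be H]]]] [dP' [A' [B' [dA' Aa' dB' Be' H']]]].
  split; first exact: definable_and.
  exists (fun x => A x /\ A' x), (fun x => B x /\ B' x).
  split=> //; try exact: definable_and.
  by move=> v [? ?] [? ?] ?; split; [apply: H | apply: H'].
- move=> P [_ [A [B [dA Aa dB Be H]]]].
  have [b [Ab Rb]] := Hfin _ (definable_comp res dA) Aa.
  exists (vcat (b \o res) e); apply: H => //.
  by exists b; split.
have [t [aut_t ta]] : exists t, automorphism t /\
    t \o (a \o res) = (fun x : X => u (inl x)).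
  apply: (homogeneous monM) => A dA Aa; apply: (Hu (fun u => A (fun x => u (inl x)))).
  split; first exact: (definable_comp inl).
  by exists A, (fun=> True); split=> //; exact: definable_true.
have [s [aut_s su]] : exists s, automorphism s /\ s \o (fun y => u (inr y)) = e.
  apply: (homogeneous monM) => B dB Bu; apply: contrapT => nBe.
  apply: (Hu (fun u => ~ B (fun y => u (inr y)))) Bu.
  split; first exact/definable_not/(definable_comp inr).
  exists (fun=> True), (fun y => ~ B y); split=> //; first exact: definable_true.
  exact: definable_not.
have [b1 [b1u Rb1]] : R1 u.
  apply: (Hu R1); split=> //.
  by exists (fun=> True), (fun=> True); split=> //; exact: definable_true.
exists (s \o (t \o a)); split=> [psi|].
  exact: iff_trans (sat_automorphism a psi aut_t) (sat_automorphism _ psi aut_s).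
have sRb1 : sat (vcat (s \o b1) e) phi.
  by rewrite -su -comp_vcat; apply: (sat_automorphism _ phi aut_s).1; apply/RE.
apply/RE; apply: (sat_lvars _ _).1 sRb1 => i il /=; congr s.
exact: etrans (b1u (SeqSub il)) (esym (congr1 (@^~ (SeqSub il)) ta)).
Qed.

Definition row_inconsistent_at (L : language) (M : structure L) (I Y : Type)
    (R : (I -> M) -> (Y -> M) -> Prop) (k : nat) (c : nat -> Y -> M) : Prop :=
  forall s : 'I_k -> nat, injective s -> ~ exists b, forall j, R b (c (s j)).

(** A pattern in tp(a) whose array is allowed to depend on the number [N] of
    columns and on the formula [P] of tp(a) to be satisfied along the paths. *)
Definition approx_pattern (L : language) (M : structure L) (I : Type)
    (a : I -> M) (D Y : Type) (R : D -> (I -> M) -> (Y -> M) -> Prop)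
    (k : D -> nat) : Prop :=
  forall (N : nat) (P : (I -> M) -> Prop), definable P -> P a ->
  exists c : D -> nat -> Y -> M,
    (forall d, row_inconsistent_at (R d) (k d) (c d)) /\
    (forall f : D -> nat, (forall d, f d < N) ->
       exists b, P b /\ forall d, R d b (c d (f d))).

(** Reduces parameter tuples indexed by an arbitrary [Y] to the finite ones
    occurring in the definition of an inp-pattern. *)
Lemma definable2_finite (L : language) (M : structure L) (I Y : Type)
    (R : (I -> M) -> (Y -> M) -> Prop) :
  definable2 R ->
  exists (m : nat) (phi : form L (I + 'I_m)) (tr : (Y -> M) -> 'I_m -> M),
    forall b y, R b y <-> sat (vcat b (tr y)) phi.
Proof.
move=> [phi Hphi]; have [pt] := carrier_inhabited M.
pose l : seq {classic Y} :=
  pmap (fun z : I + Y => if z is inr y then Some y else None) (vars phi).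
pose g (z : I + Y) : I + 'I_(size l).+1 := match z with
  | inl i => inl i | inr y => inr (inord (index (y : {classic Y}) l)) end.
exists (size l).+1, (form_map g phi).
exists (fun y j => nth pt [seq y z | z <- l] j) => b y.
rewrite sat_map (Hphi (vcat b y)); apply: sat_vars => -[i|z] zphi //=.
have zl : (z : {classic Y}) \in l.
  exact: (mem_classic_pmap (f := fun z : I + Y =>
            if z is inr y then Some y else None)) zphi.
rewrite inordK ?ltnS ?index_size // (nth_map z) ?index_mem //.
by congr y; apply/esym; apply: (@nth_index {classic Y}).
Qed.

(** Compactness.  The entries of the array are countably many variables, as the
    depth is finite and each entry is a finite tuple.  Inconsistency of the rows
    and satisfiability of the paths with each formula of tp(a) are definable
    conditions on them, finitely satisfiable by hypothesis, so some array in [M]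
    satisfies them all; [realize_over_type] then upgrades each path to a
    realization of tp(a). *)
Lemma inp_pattern_of_approx (L : language) (M : structure L) (K I : Type)
    (a : I -> M) (D : finType) (Y : Type)
    (R : D -> (I -> M) -> (Y -> M) -> Prop) (k : D -> nat) :
  monster M K -> (forall d, definable2 (R d)) -> approx_pattern a R k ->
  inhabited (inp_pattern (tp a set0) D).
Proof.
move=> monM Rdef app.
have [m Hm] := boolp.choice (fun d => definable2_finite (Rdef d)).
have {Hm} [phi Hphi] : exists phi : forall d, form L (I + 'I_(m d)),
    forall d, exists tr : (Y -> M) -> 'I_(m d) -> M,
    forall b y, R d b y <-> sat (vcat b (tr y)) (phi d).
  have [phi Hphi] := all_sig (fun d => cid (Hm d)).
  by exists phi.
have {Hphi} [tr Htr] : exists tr : forall d, (Y -> M) -> 'I_(m d) -> M,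
    forall d b y, R d b y <-> sat (vcat b (tr d y)) (phi d).
  have [tr Htr] := all_sig (fun d => cid (Hphi d)).
  by exists tr.
pose Q d (b : I -> M) (w : 'I_(m d) -> M) := sat (vcat b w) (phi d).
have Qdef d : definable2 (Q d) by exact: definable2_sat.
pose V : countType := (D * nat * nat)%type.
pose slice (u : V -> M) d i := fun j : 'I_(m d) => u (d, i, val j).
pose cond N (P : (I -> M) -> Prop) (u : V -> M) :=
  (forall d, row_inconsistent_at (Q d) (k d) (slice u d)) /\
  (forall f : D -> nat, (forall d, f d < N) ->
       exists b, P b /\ forall d, Q d b (slice u d (f d))).
pose S : set ((V -> M) -> Prop) := [set A | definable A /\
  exists N P, [/\ definable P, P a & forall u, cond N P u -> A u]].
have [pt] := carrier_inhabited M.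
have [||||e He] := @realize L M K _ S monM.
- by move=> A [].
- split; first exact: definable_true.
  by exists 0, (fun=> True); split=> //; exact: definable_true.
- move=> A A' [dA [N [P [dP Pa H]]]] [dA' [N' [P' [dP' Pa' H']]]].
  split; first exact: definable_and.
  exists (maxn N N'), (fun b => P b /\ P' b); split=> //.
    exact: definable_and.
  move=> u [rows paths]; split.
    apply: H; split=> // f fN; have [d|b [[Pb _] Hb]] := paths f.
      by rewrite leq_max fN.
    by exists b.
  apply: H'; split=> // f fN; have [d|b [[_ Pb] Hb]] := paths f.
    by rewrite leq_max fN orbT.
  by exists b.
- move=> A [_ [N [P [dP Pa H]]]]; have [c [rows paths]] := app N P dP Pa.
  pose u (z : V) := let: (d, i, j) := z in
    if insub j is Some j' then tr d (c d i) j' else pt.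
  exists u; apply: H.
  have sliceE d i : slice u d i = tr d (c d i).
    by apply: funext => j; rewrite /slice /u valK.
  split=> [d s s_inj [b Hb]|f fN].
    apply: (rows d s s_inj); exists b => j; apply/Htr.
    by rewrite -sliceE; exact: Hb.
  have [b [Pb Hb]] := paths f fN; exists b; split=> // d.
  by rewrite sliceE; apply/Htr.
have rows d : row_inconsistent_at (Q d) (k d) (slice e d).
  move=> s s_inj.
  apply: (He (fun u => ~ exists b, forall j, Q d b (slice u d (s j)))).
  split.
    apply/definable_not/definable_ex/definable_forall => j.
    exact: (definable_rel inl (fun i => inr (d, s j, val i)) (Qdef d)).
  exists 0, (fun=> True); split=> //; first exact: definable_true.
  by move=> u [H _]; exact: H.
have paths (f : D -> nat) : exists b, (forall psi, sat a psi <-> sat b psi) /\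
    forall d, Q d b (slice e d (f d)).
  apply: (realize_over_type (R := fun b u => forall d, Q d b (slice u d (f d)))
            monM).
    apply: definable_forall => d.
    exact: (definable_rel inl (fun i => inr (d, f d, val i)) (Qdef d)).
  move=> P dP Pa.
  apply: (He (fun u => exists b, P b /\ forall d, Q d b (slice u d (f d)))).
  split.
    apply/definable_ex/definable_and; first exact: (definable_comp inl).
    apply: definable_forall => d.
    exact: (definable_rel inl (fun i => inr (d, f d, val i)) (Qdef d)).
  exists (\max_d f d).+1, P; split=> // u [_ H]; apply: H => d.
  by rewrite ltnS leq_bigmax.
split; apply: (@Build_inp_pattern L M I _ D m (slice e) phi k).
  move=> d s s_inj /(consistent_realized
    (phi := fun j : 'I_(k d) => inst (slice e d (s j)) (phi d))) [].
    by move=> j; exists j.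
  move=> b Hb; apply: (rows d s s_inj); exists b => j.
  exact/psat_inst/Hb.
move=> f; have [b [ab Hb]] := paths f.
exists M, id, b; split; first by move=> W psi v.
move=> psi [[d ->]|[[chi ->] Ha]].
  exact/psat_inst/Hb.
change (psat b (inst (fun c : {c | set0 c} => sval c) chi)).
move: Ha => /psat_inst Ha; apply/psat_inst.
pose g (z : I + {c : M | set0 c}) : I :=
  match z with inl i => i | inr x => False_rect I (svalP x) end.
have gE (b' : I -> M) : vcat b' (fun c : {c : M | set0 c} => sval c) = b' \o g.
  by apply: funext => -[//|[x []]].
move: Ha; rewrite !gE => Ha.
exact: (sat_map g b chi).1 ((ab _).1 ((sat_map g a chi).2 Ha)).
Qed.

Definition is_pattern (L : language) (M : structure L) (I : Type)
    (a : I -> M) (D Y : Type) (R : D -> (I -> M) -> (Y -> M) -> Prop)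
    (k : D -> nat) (c : D -> nat -> Y -> M) : Prop :=
  (forall d, row_inconsistent_at (R d) (k d) (c d)) /\
  (forall f P, definable P -> P a ->
     exists b, P b /\ forall d, R d b (c d (f d))).

(** Parameter tuples are padded to have index type [nat], so that all rows have
    the same shape. *)
Lemma pattern_of_inp_pattern (L : language) (M : structure L) (I : Type)
    (a : I -> M) (D : finType) :
  inp_pattern (tp a set0) D ->
  exists (R : D -> (I -> M) -> (nat -> M) -> Prop) k c,
    (forall d, definable2 (R d)) /\ is_pattern a R k c.
Proof.
move=> p; have [pt] := carrier_inhabited M.
exists (fun d b y => sat (vcat b (fun j : 'I_(ysize p d) => y (val j))) (@fml _ _ _ _ _ p d)).
exists (knum p).
exists (fun d i j => if insub j is Some j' then @array _ _ _ _ _ p d i j' else pt).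
have E d i : (fun j : 'I_(ysize p d) => if insub (val j) is Some j'
    then @array _ _ _ _ _ p d i j' else pt) = @array _ _ _ _ _ p d i.
  by apply: funext => j; rewrite valK.
split=> [d|].
  exact: (definable_rel inl (fun j : 'I_(ysize p d) => inr (val j)) (definable2_sat _ _)).
split=> [d s s_inj [b Hb]|f P [phi Hphi] Pa].
  apply: (@row_inconsistent _ _ _ _ _ p d s s_inj); exists M, id, b; split.
    by move=> W psi v.
  by move=> psi [j ->]; apply/psat_inst; rewrite -E; exact: Hb.
pose psi (z : option D) : pform M I := if z is Some d
  then inst (@array _ _ _ _ _ p d (f d)) (@fml _ _ _ _ _ p d)
  else inst (fun c : {c : M | set0 c} => sval c) (form_map inl phi).
have [z|b Hb] := consistent_realized (phi := psi) (path_consistent p f).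
  case: z => [d|]; first by left; exists d.
  right; split; first by exists (form_map inl phi).
  by apply/psat_inst; rewrite sat_map; apply/Hphi.
exists b; split.
  by move: (Hb None) => /psat_inst; rewrite sat_map => /Hphi.
by move=> d; move: (Hb (Some d)) => /psat_inst; rewrite E.
Qed.

(** * Mutually indiscernible arrays *)

Definition upd (T : eqType) (s : T -> nat) (x : T) (n : nat) : T -> nat :=
  fun y => if y == x then n else s y.

(** [almost_all U l P s] says: for [U]-almost all values of the first coordinate
    in [l], for [U]-almost all values of the second one, and so on, [P] holds of
    [s] with its coordinates in [l] replaced by these values. *)
Fixpoint almost_all (U : set_system nat) (T : eqType) (l : seq T)
    (P : (T -> nat) -> Prop) (s : T -> nat) : Prop :=
  if l is x :: l' then U [set n | almost_all U l' P (upd s x n)] else P s.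

Lemma almost_all_mono (U : set_system nat) (T : eqType) (l : seq T)
    (P Q : (T -> nat) -> Prop) (s : T -> nat) :
  UltraFilter U -> (forall s, P s -> Q s) ->
  almost_all U l P s -> almost_all U l Q s.
Proof.
move=> UU PQ; elim: l s => [|x l IH] s //=; first exact: PQ.
by apply: filterS => n; exact: IH.
Qed.

Lemma almost_all_and (U : set_system nat) (T : eqType) (l : seq T)
    (P Q : (T -> nat) -> Prop) (s : T -> nat) :
  UltraFilter U -> almost_all U l P s -> almost_all U l Q s ->
  almost_all U l (fun s => P s /\ Q s) s.
Proof.
move=> UU; elim: l s => [|x l IH] s //=.
by apply: filterS2 => n; exact: IH.
Qed.

Lemma almost_all_all (U : set_system nat) (T : eqType) (l : seq T)
    (P : (T -> nat) -> Prop) (s : T -> nat) :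
  UltraFilter U -> (forall s, P s) -> almost_all U l P s.
Proof.
move=> UU HP; elim: l s => [|x l IH] s //=.
by apply: filterS filterT => n _; exact: IH.
Qed.

Lemma almost_all_not (U : set_system nat) (T : eqType) (l : seq T)
    (P : (T -> nat) -> Prop) (s : T -> nat) :
  UltraFilter U -> ~ almost_all U l P s -> almost_all U l (fun s => ~ P s) s.
Proof.
move=> UU; elim: l s => [|x l IH] s //= nU.
have [//|] := in_ultra_setVsetC [set n | almost_all U l P (upd s x n)] UU.
by apply: filterS => n; exact: IH.
Qed.

Lemma almost_all_ex (U : set_system nat) (T : eqType) (l : seq T)
    (P : (T -> nat) -> Prop) (s : T -> nat) :
  UltraFilter U -> almost_all U l P s -> exists s', P s'.
Proof.
move=> UU; elim: l s => [|x l IH] s /=; first by exists s.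
by move/filter_ex => [n]; exact: IH.
Qed.

Lemma almost_all_indep (U : set_system nat) (T : eqType) (l : seq T)
    (P : (T -> nat) -> Prop) (x : T) :
  UltraFilter U ->
  (forall s s', (forall y, y != x -> s y = s' y) -> P s -> P s') ->
  forall s s', (forall y, y != x -> s y = s' y) ->
  almost_all U l P s -> almost_all U l P s'.
Proof.
move=> UU HP; elim: l => [|z l IH] s s' ss' /=; first exact: HP.
apply: filterS => n; apply: IH => y yx; rewrite /upd.
by case: eqP => // _; exact: ss'.
Qed.

(** Quantifiers over coordinates on which [P] does not depend can be dropped. *)
Lemma almost_all_filter (U : set_system nat) (T : eqType) (l : seq T)
    (P : (T -> nat) -> Prop) (p : pred T) (s : T -> nat) :
  UltraFilter U ->
  (forall s s', (forall y, p y -> s y = s' y) -> P s -> P s') ->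
  almost_all U l P s <-> almost_all U (seq.filter p l) P s.
Proof.
move=> UU HP; elim: l s => [|x l IH] s //=.
case: ifPn => px /=.
  by split; apply: filterS => n /=; rewrite IH.
have ind n : almost_all U (seq.filter p l) P (upd s x n) <->
             almost_all U (seq.filter p l) P s.
  have HPx s1 s2 : (forall y, y != x -> s1 y = s2 y) -> P s1 -> P s2.
    move=> H; apply: HP => y py; apply: H.
    by apply: contraNN px => /eqP <-.
  by split; apply: (almost_all_indep UU HPx) => y /negbTE yx; rewrite /upd yx.
rewrite -IH; split=> [/filter_ex[n] /=|H]; first by rewrite IH ind -IH.
by apply: filterS filterT => n _; rewrite /= IH ind -IH.
Qed.

Lemma almost_all_map (U : set_system nat) (T T' : eqType) (r : T -> T')
    (l : seq T) (P : (T -> nat) -> Prop) (s : T' -> nat) :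
  injective r ->
  almost_all U (map r l) (fun s => P (s \o r)) s = almost_all U l P (s \o r).
Proof.
move=> r_inj; elim: l s => [|x l IH] s //=; congr U; apply: funext => n /=.
rewrite IH; congr almost_all; apply: funext => y.
by rewrite /upd /= (inj_eq r_inj).
Qed.

Lemma almost_all_fixed (U : set_system nat) (T : eqType) (l : seq T) (x : T)
    (s : T -> nat) :
  UltraFilter U -> x \notin l -> almost_all U l (fun s' => s' x = s x) s.
Proof.
move=> UU; elim: l s => [|y l IH] s //=; rewrite in_cons negb_or.
case/andP=> /negbTE xy xl; apply: filterS filterT => n _ /=.
have E : upd s y n x = s x by rewrite /upd xy.
by rewrite -E; exact: IH.
Qed.

(** Since [U] is nonprincipal, each new value almost surely avoids the finitely
    many previous ones and those in [A]; the set [A] is there for the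
    induction. *)
Lemma almost_all_uniq (U : set_system nat) (T : eqType) (l : seq T)
    (A : seq nat) (s : T -> nat) :
  UltraFilter U -> \oo `<=` U -> uniq l ->
  almost_all U l
    (fun s => uniq (map s l) /\ forall x, x \in l -> s x \notin A) s.
Proof.
move=> UU Uoo; elim: l A s => [|x l IH] A s //= /andP[xl ul].
have : U [set n | (\max_(a <- A) a).+1 <= n] by apply: Uoo; exists (\max_(a <- A) a).+1.
apply: filterS => n /= nA.
have nNA : n \notin A.
  apply/negP => /(leq_bigmax_seq (F := id)) /(_ isT) /=.
  by rewrite leqNgt nA.
have := almost_all_and UU (IH (n :: A) (upd s x n) ul)
                          (almost_all_fixed (upd s x n) UU xl).
apply: almost_all_mono => s' [[us' s'A] s'x].
have {}s'x : s' x = n by rewrite s'x /upd eqxx.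
split=> [|y].
  rewrite us' andbT s'x; apply/mapP => -[y yl ny].
  by have := s'A y yl; rewrite in_cons negb_or -ny eqxx.
rewrite in_cons => /orP[/eqP ->|yl]; first by rewrite s'x.
by have := s'A y yl; rewrite in_cons negb_or => /andP[].
Qed.

Lemma subseq_map_iota (f : nat -> nat) (N N' : nat) :
  {homo f : i j / i < j} -> (forall i, i < N -> f i < N') ->
  subseq (map f (iota 0 N)) (iota 0 N').
Proof.
move=> fI fN.
rewrite (_ : map f (iota 0 N) = seq.filter (mem (map f (iota 0 N))) (iota 0 N')).
  exact: filter_subseq.
apply: (irr_sorted_eq ltn_trans ltnn).
- by rewrite sorted_map; apply: sub_sorted (iota_ltn_sorted 0 N) => i j; exact: fI.
- exact: (sorted_filter ltn_trans _ (iota_ltn_sorted _ _)).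
move=> x; rewrite mem_filter inE andb_idr //= => /mapP[i].
by rewrite !mem_iota /= !add0n => iN ->; exact: fN.
Qed.

Definition cells (D : finType) (N : nat) : seq (D * nat) :=
  [seq (d, i) | d <- enum D, i <- iota 0 N].

Lemma mem_cells (D : finType) (N : nat) (d : D) (i : nat) :
  ((d, i) \in cells D N) = (i < N).
Proof.
apply/allpairsP/idP => [[[d' i'] /= [_]]|iN].
  by rewrite mem_iota => iN' [_ ->].
by exists (d, i); split=> //=; rewrite ?mem_enum // mem_iota.
Qed.

Lemma cells_uniq (D : finType) (N : nat) : uniq (cells D N).
Proof.
by apply: allpairs_uniq; rewrite ?enum_uniq ?iota_uniq // => -[? ?] [? ?].
Qed.

Definition relabel (D : Type) (f : D -> nat -> nat) (x : D * nat) : D * nat :=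
  (x.1, f x.1 x.2).

(** Increasing relabelings of the columns preserve the order in which the cells
    are quantified; this is the source of indiscernibility. *)
Lemma subseq_cells (D : finType) (f : D -> nat -> nat) (N N' : nat) :
  (forall d, {homo f d : i j / i < j}) ->
  (forall d i, i < N -> f d i < N') ->
  subseq (map (relabel f) (cells D N)) (cells D N').
Proof.
move=> fI fN; rewrite /cells; elim: (enum D) => //= d ds IH.
rewrite map_cat cat_subseq // -map_comp.
rewrite (_ : map _ _ = map (pair d) (map (f d) (iota 0 N))); last first.
  by rewrite -map_comp.
apply: map_subseq; apply: subseq_map_iota => // i; exact: fN.
Qed.

Lemma definable_bounded (L : language) (M : structure L) (D Y : Type)
    (P : (D * nat * Y -> M) -> Prop) :
  definable P -> exists N, forall u u' : D * nat * Y -> M,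
    (forall d i y, i < N -> u (d, i, y) = u' (d, i, y)) -> P u -> P u'.
Proof.
move=> [phi Hphi].
have [N HN] : exists N, forall d i y,
    ((d, i, y) : {classic D * nat * Y}) \in vars phi -> i < N.
  elim: (vars phi) => [|[[d0 i0] y0] s [N H]]; first by exists 0.
  exists (maxn N i0.+1) => d i y; rewrite in_cons leq_max.
  by move=> /orP[/eqP[_ -> _]|/H ->//]; rewrite ltnSn orbT.
exists N => u u' uu' /Hphi Pu; apply/Hphi.
rewrite -(@sat_vars _ _ _ phi u u') // => -[[d i] y] /HN; exact: uu'.
Qed.

Lemma uniq_map_inj (T : eqType) (f : T -> nat) (l : seq T) :
  uniq (map f l) -> {in l &, injective f}.
Proof.
elim: l => // x l IH /= /andP[xl ul] y z; rewrite !in_cons.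
move=> /orP[/eqP ->|yl] /orP[/eqP ->|zl] fyz //; last exact: IH.
  by move: xl; rewrite fyz map_f.
by move: xl; rewrite -fyz map_f.
Qed.

(** The second clause says that [e] inherits what holds of all arrays obtained
    from [c] by picking, for each cell, an entry of its row, the first [N] cells
    of a row receiving distinct entries.

    The array [e] realizes the type of all [P] holding for almost all choices of
    entries.  If [P] depends on the columns below [N], the quantifiers over
    other cells are irrelevant, and after an increasing relabeling of the
    columns the remaining ones are the same, in the same order: the type is
    invariant under such relabelings. *)
Lemma indiscernible_array (L : language) (M : structure L) (K : Type)
    (D : finType) (Y : countType) (c : D * nat * Y -> M) :
  monster M K ->
  exists e : D * nat * Y -> M,
  (forall (f : D -> nat -> nat) P, (forall d, {homo f d : i j / i < j}) ->
     definable P -> P e <-> P (fun z => e (relabel f z.1, z.2))) /\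
  (forall P N, definable P ->
     (forall s : D * nat -> nat,
        (forall d i j, i < N -> j < N -> s (d, i) = s (d, j) -> i = j) ->
        P (fun z => c (z.1.1, s z.1, z.2))) -> P e).
Proof.
move=> monM.
have [U [UU Uoo]] := ultraFilterLemma eventually_filter.
pose dep N (P : (D * nat * Y -> M) -> Prop) := forall u u',
  (forall d i y, i < N -> u (d, i, y) = u' (d, i, y)) -> P u -> P u'.
pose pull (s : D * nat -> nat) (z : D * nat * Y) := c (z.1.1, s z.1, z.2).
pose s0 (x : D * nat) := 0.
pose lim N (P : (D * nat * Y -> M) -> Prop) :=
  almost_all U (cells D N) (fun s => P (pull s)) s0.
have limR N N' (f : D -> nat -> nat) P : dep N P ->
    (forall d, {homo f d : i j / i < j}) ->
    (forall d i, i < N -> f d i < N') ->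
    lim N P <-> lim N' (fun u => P (fun z => u (relabel f z.1, z.2))).
  move=> dP fI fN; pose r := relabel f.
  have r_inj : injective r.
    have f_inj d : injective (f d).
      move=> i j; case: (ltngtP i j) => // /(fI d) + E; rewrite E ltnn //.
    by move=> [d i] [d' j] [<-] /f_inj ->.
  have E : seq.filter (mem (map r (cells D N))) (cells D N') = map r (cells D N).
    by apply/esym/subseq_uniqP/(subseq_cells fI fN); exact: cells_uniq.
  rewrite /lim (@almost_all_filter U _ (cells D N')
    (fun s => P (fun z => pull s (relabel f z.1, z.2)))
    (mem (map r (cells D N))) s0 UU); last first.
    move=> s s' ss'; apply: dP => d i y iN.
    have di : r (d, i) \in map r (cells D N) by apply: map_f; rewrite mem_cells.
    by rewrite /pull; congr (c (_, _, _)); exact: (ss' _ di).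
  by rewrite E (almost_all_map U (cells D N) (fun s => P (pull s)) s0 r_inj).
have limN N N' P : dep N P -> N <= N' -> lim N P -> lim N' P.
  move=> dP NN'; rewrite (limR N N' (fun=> id) P) //.
  - by rewrite (_ : (fun u => _) = P) //; apply: funext => u;
      congr P; apply: funext => -[[d i] y].
  - by move=> _ i j.
  - by move=> d i iN; exact: leq_trans iN NN'.
have depN N N' P : dep N P -> N <= N' -> dep N' P.
  by move=> dP NN' u u' uu'; apply: dP => d i y iN; apply: uu'; exact: leq_trans iN NN'.
pose S : set ((D * nat * Y -> M) -> Prop) :=
  [set P | definable P /\ exists N, dep N P /\ lim N P].
have [||||e He] := @realize L M K _ S monM.
- by move=> P [].
- split; first exact: definable_true.
  by exists 0; split=> //; exact: almost_all_all.
- move=> P P' [dP [N [NP lP]]] [dP' [N' [NP' lP']]].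
  split; first exact: definable_and.
  exists (maxn N N'); split.
    move=> u u' uu' [Pu Pu'].
    split; [apply: NP Pu|apply: NP' Pu'] => d i y iN; apply: uu'.
      by rewrite leq_max iN.
    by rewrite leq_max iN orbT.
  apply: almost_all_and.
    by apply: limN lP => //; rewrite leq_maxl.
  by apply: limN lP' => //; rewrite leq_maxr.
- by move=> P [_ [N [_ /almost_all_ex[s Ps]]]]; exists (pull s).
have limE N P (f : D -> nat -> nat) : (forall d, {homo f d : i j / i < j}) ->
    definable P -> dep N P -> lim N P ->
    P e /\ P (fun z => e (relabel f z.1, z.2)).
  move=> fI dP NP lP; split; first by apply: He; split=> //; exists N.
  pose N' := \max_(d : D) f d N.
  have fN d i : i < N -> f d i < N'.
    by move=> /(fI d) fiN; apply: leq_trans fiN _; rewrite leq_bigmax.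
  apply: (He (fun u => P (fun z => u (relabel f z.1, z.2)))).
  split; first exact: (definable_comp (fun z : D * nat * Y => (relabel f z.1, z.2))).
  exists N'; split; last exact/(limR N N').
  by move=> u u' uu'; apply: NP => d i y iN; apply: uu'; exact: fN.
exists e; split=> [f P fI dP|P N dP HP].
  have [N NP] := definable_bounded dP.
  have [lP|nlP] := EM (lim N P); first by have [? ?] := limE N P f fI dP NP lP.
  have NnP : dep N (fun u => ~ P u).
    by move=> u u' uu' nPu Pu'; apply: nPu; apply: NP Pu' => d i y /uu'.
  have [? ?] := limE N (fun u => ~ P u) f fI (definable_not dP) NnP
                  (almost_all_not UU nlP).
  by split.
have [N1 NP] := definable_bounded dP.
apply: He; split=> //; exists (maxn N N1); split.
  by apply: depN NP _; rewrite leq_maxr.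
have := almost_all_uniq [::] s0 UU Uoo (cells_uniq D (maxn N N1)).
apply: almost_all_mono => s [us _]; apply: HP => d i j iN jN sij.
have ltN k : k < N -> (d, k) \in cells D (maxn N N1).
  by move=> kN; rewrite mem_cells leq_max kN.
have [//] : (d, i) = (d, j).
by apply: (uniq_map_inj us) => //; exact: ltN.
Qed.

(** * Inp-patterns in the type of a pair *)

(** Any [k] distinct columns may be listed in increasing order, and
    indiscernibility then compares them with the first [k] ones; values beyond
    [k] only serve to have an increasing function on all of [nat]. *)
Lemma increasing_enumeration (k : nat) (s : 'I_k -> nat) :
  injective s ->
  exists t : nat -> nat, {homo t : i j / i < j} /\
    forall j : 'I_k, exists i, t j = s i.
Proof.
move=> s_inj; pose l := sort leq (codom s).
have size_l : size l = k by rewrite size_sort size_codom card_ord.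
have l_sorted : sorted ltn l.
  rewrite ltn_sorted_uniq_leq sort_uniq sort_sorted ?andbT; last exact: leq_total.
  by rewrite map_inj_uniq ?enum_uniq.
have l_bound x : x \in l -> x < (\max_(y <- l) y).+1.
  by move=> xl; rewrite ltnS (leq_bigmax_seq (F := id)).
exists (fun j => if j < k then nth 0 l j else (\max_(y <- l) y).+1 + j); split.
  move=> i j ij; case: (ltnP j k) => jk.
    rewrite (ltn_trans ij jk); apply: (sorted_ltn_nth ltn_trans) => //;
    by rewrite inE size_l // (ltn_trans ij).
  case: ifP => ik; last by rewrite ltn_add2l.
  by apply: leq_trans (leq_addr _ _); apply: l_bound; rewrite mem_nth ?size_l.
move=> j; rewrite ltn_ord.
have : nth 0 l j \in l by rewrite mem_nth ?size_l.
by rewrite mem_sort => /codomP[i ->]; exists i.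
Qed.

Lemma definable_comp_vcat (L : language) (M : structure L) (I J W : Type)
    (f : I -> W) (g : J -> W) (P : (I + J -> M) -> Prop) :
  definable P ->
  definable (fun w => P (vcat (fun i => w (f i)) (fun j => w (g j)))).
Proof.
move=> /(definable_comp (vcat f g)) [phi H]; exists phi => w.
by rewrite -H (_ : vcat _ _ = w \o vcat f g) // comp_vcat.
Qed.

Lemma definable_rel_vcat (L : language) (M : structure L) (I J Y W : Type)
    (f : I -> W) (g : J -> W) (h : Y -> W)
    (R : (I + J -> M) -> (Y -> M) -> Prop) :
  definable2 R ->
  definable (fun w =>
    R (vcat (fun i => w (f i)) (fun j => w (g j))) (fun y => w (h y))).
Proof.
move=> /(definable_rel (vcat f g) h) [phi H]; exists phi => w.
by rewrite -H (_ : vcat _ _ = w \o vcat f g) // comp_vcat.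
Qed.

(** Inconsistency of a row survives since, by indiscernibility, it suffices to
    look at its first columns, which come from distinct entries of [c]; for the
    paths it suffices to look at column 0. *)
Lemma indiscernible_pattern (L : language) (M : structure L) (K I : Type)
    (D : finType) (Y : countType) (a : I -> M)
    (R : D -> (I -> M) -> (Y -> M) -> Prop) (k : D -> nat)
    (c : D -> nat -> Y -> M) :
  monster M K -> (forall d, definable2 (R d)) -> is_pattern a R k c ->
  exists e : D * nat * Y -> M,
  [/\ forall (f : D -> nat -> nat) P, (forall d, {homo f d : i j / i < j}) ->
        definable P -> P e <-> P (fun z => e (relabel f z.1, z.2)),
      forall d, row_inconsistent_at (R d) (k d) (fun i y => e (d, i, y)) &
      forall P, definable P -> P a ->
        exists b, P b /\ forall d, R d b (fun y => e (d, 0, y))].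
Proof.
move=> monM Rdef [rows paths].
have [e [ind em]] := indiscernible_array (fun z => c z.1.1 z.1.2 z.2) monM.
exists e; split=> //; last first.
  move=> P dP Pa.
  apply: (em (fun u => exists b, P b /\ forall d, R d b (fun y => u (d, 0, y))) 0).
    apply/definable_ex/definable_and; first exact: (definable_comp inl).
    apply: definable_forall => d.
    exact: (definable_rel inl (fun y => inr (d, 0, y)) (Rdef d)).
  by move=> s _; exact: (paths (fun d => s (d, 0))).
move=> d s s_inj [b Hb]; have [t [t_incr ts]] := increasing_enumeration s_inj.
pose P (u : D * nat * Y -> M) :=
  ~ exists b, forall j : 'I_(k d), R d b (fun y => u (d, val j, y)).
have dP : definable P.
  apply/definable_not/definable_ex/definable_forall => j.
  exact: (definable_rel inl (fun y => inr (d, val j, y)) (Rdef d)).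
have : P e.
  apply: (em P (k d)) => // s' s'_inj; apply: (rows d (fun j => s' (d, val j))).
  by move=> i j sij; apply: val_inj; apply: s'_inj sij; exact: ltn_ord.
rewrite (ind (fun _ => t)) //; apply; exists b => j.
by have [i E] := ts j; rewrite /relabel /= E; exact: Hb.
Qed.

(** The relation [sel] selects the rows under consideration and [ix f x] is the
    entry of the rows of block [x] used for the choice [f].  The tuple [b2] must
    work for all choices [f], whereas [b1] may depend on the choice. *)
Definition uniform_in (L : language) (M : structure L) (I1 I2 : Type)
    (A B : finType) (Y : Type)
    (R : A * B -> (I1 + I2 -> M) -> (Y -> M) -> Prop)
    (sel : A -> B -> Prop) (N : nat)
    (ix : {ffun A -> 'I_N.+1} -> A -> nat) (P : (I1 + I2 -> M) -> Prop)
    (b2 : I2 -> M) (u : A * B * nat * Y -> M) : Prop :=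
  forall f, exists b1, P (vcat b1 b2) /\
    forall x y, sel x y ->
      R (x, y) (vcat b1 b2) (fun j => u (x, y, ix f x, j)).

Lemma definable_uniform_in (L : language) (M : structure L) (I1 I2 : Type)
    (A B : finType) (Y : Type)
    (R : A * B -> (I1 + I2 -> M) -> (Y -> M) -> Prop)
    (sel : A -> B -> Prop) (N : nat)
    (ix : {ffun A -> 'I_N.+1} -> A -> nat) (P : (I1 + I2 -> M) -> Prop) :
  (forall d, definable2 (R d)) -> definable P ->
  definable2 (uniform_in R sel ix P).
Proof.
move=> Rdef Pdef; apply: definable_forall => f; apply: definable_ex.
apply: definable_and; first exact: (definable_comp_vcat inl (fun i => inr (inl i))).
apply: definable_forall => x; apply: definable_forall => y.
apply: definable_imp.
exact: (definable_rel_vcat inl (fun i => inr (inl i))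
          (fun j => inr (inr (x, y, ix f x, j)))).
Qed.

Lemma inp_pattern_empty (L : language) (M : structure L) (K I : Type)
    (a : I -> M) (D : finType) :
  monster M K -> (D -> False) -> inhabited (inp_pattern (tp a set0) D).
Proof.
move=> monM D0.
apply: (@inp_pattern_of_approx L M K I a D nat (fun _ _ _ => True) (fun=> 0) monM).
  by move=> d; case: (D0 d).
move=> N P dP Pa; have [pt] := carrier_inhabited M.
exists (fun _ _ _ => pt); split; first by move=> d; case: (D0 d).
by move=> f _; exists a.
Qed.

(** In the proof, [s] lists the blocks already treated, with chosen rows [g]:
    [sel s g] keeps the chosen rows of the blocks in [s] and all rows of the
    other blocks, and [ix s] lets the choice range over the former while fixing
    entry 0 in the latter.  The row chosen in a block must not depend on [N] and
    [P], hence the quantifiers in [C].  When no row of block [x] can be added,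
    each row [y] fails for some [N] and [P], and as [B] is finite there is a
    common failure. *)
Lemma inp_pattern_product (L : language) (M : structure L) (K I1 I2 : Type)
    (a1 : I1 -> M) (a2 : I2 -> M) (A B : finType) :
  monster M K ->
  inp_pattern (tp (vcat a1 a2) set0) (A * B)%type ->
  ~ inhabited (inp_pattern (tp a2 set0) B) ->
  inhabited (inp_pattern (tp a1 set0) A).
Proof.
move=> monM /pattern_of_inp_pattern[R [k [c [Rdef pat]]]] no2.
have [y0] : inhabited B.
  apply: contrapT => nB; apply: no2; apply: (inp_pattern_empty _ monM) => y.
  by apply: nB; split.
have [e [ind rows base]] := indiscernible_pattern monM Rdef pat.
pose ix (s : seq A) N (f : {ffun A -> 'I_N.+1}) (x : A) : nat :=
  if x \in s then val (f x) else 0.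
pose sel (s : seq A) (g : A -> B) x y := x \in s -> y = g x.
pose G s g N := uniform_in R (sel s g) (@ix s N).
pose C s := exists g : A -> B, forall N P, definable P -> P (vcat a1 a2) ->
  exists b2, G s g N P b2 e.
have G_mono s g N N' (P P' : (I1 + I2 -> M) -> Prop) b2 u :
    N' <= N -> (forall b, P b -> P' b) -> G s g N P b2 u -> G s g N' P' b2 u.
  move=> NN' PP' H f.
  have [b1 [Pb Hb]] := H [ffun x => widen_ord (NN' : N'.+1 <= N.+1) (f x)].
  exists b1; split; first exact: PP'.
  by move=> x y /Hb; rewrite /ix ffunE.
have C0 : C [::].
  exists (fun=> y0) => N P dP Pa; have [b [Pb Hb]] := base P dP Pa.
  have bE : vcat (b \o inl) (b \o inr) = b by apply: funext => -[].
  by exists (b \o inr) => f; exists (b \o inl); rewrite bE; split.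
have Cstep x s : x \notin s -> C s -> C (x :: s).
  move=> xs [g Hg]; apply: contrapT => nC.
  pose gx y : A -> B := fun x' => if x' == x then y else g x'.
  have /boolp.choice[NP HNP] y : exists NP : nat * ((I1 + I2 -> M) -> Prop),
      [/\ definable NP.2, NP.2 (vcat a1 a2) &
          ~ exists b2, G (x :: s) (gx y) NP.1 NP.2 b2 e].
    apply: contrapT => H; apply: nC; exists (gx y) => N P dP Pa.
    by apply: contrapT => nG; apply: H; exists (N, P).
  pose N := \max_y (NP y).1.
  pose P b := forall y, (NP y).2 b.
  have dP : definable P by apply: definable_forall => y; case: (HNP y).
  have Pa : P (vcat a1 a2) by move=> y; case: (HNP y).
  have nG y : ~ exists b2, G (x :: s) (gx y) N P b2 e.
    move=> [b2 H]; case: (HNP y) => _ _; apply; exists b2.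
    by apply: G_mono H; [rewrite leq_bigmax | move=> b; exact].
  pose shift y n (z : A * B * nat) : A * B * nat :=
    if (z.1 == (x, y)) && (z.2 == 0) then (z.1, n) else z.
  (* The parameter of entry [n] of row [y] is the whole array, with the entry 0
     of row (x, y) replaced by its entry [n]; all formulas are about entry 0. *)
  apply: no2.
  apply: (@inp_pattern_of_approx L M K I2 a2 B _
    (fun y => uniform_in R (sel (x :: s) (gx y)) (@ix s N) P)
    (fun=> N.+1) monM).
    by move=> y; exact: definable_uniform_in.
  move=> N0 P2 dP2 P2a.
  exists (fun y n z => e (shift y n z.1, z.2)); split.
    move=> y t t_inj [b2 Hb2]; have [r [r_incr rt]] := increasing_enumeration t_inj.
    (* An [x2] accepting the N + 1 entries listed by [r] allows, in the array
       spread along [r] in row (x, y), to choose that row. *)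
    pose f (d : A * B) : nat -> nat := if d == (x, y) then r else id.
    have f_incr d : {homo f d : i j / i < j} by rewrite /f; case: ifP => // _ i j.
    apply: (nG y).
    apply/(ind f (fun u => exists b2, G (x :: s) (gx y) N P b2 u) f_incr).
      exact/definable_ex/definable_uniform_in.
    exists b2 => h.
    have [i ri] := rt (h x); have [b1 [Pb Hb]] := Hb2 i h.
    exists b1; split=> // x' y' xy'; move: (Hb x' y' xy').
    congr (R _ _ _); apply: funext => j; congr (e (_, _)).
    rewrite /relabel /shift /f /= /ix in_cons; case: (eqVneq x' x) => [xx|xx] /=.
      have -> : y' = y.
        by rewrite (xy' _) /gx ?xx ?eqxx // in_cons eqxx.
      by rewrite xx (negbTE xs) !eqxx /= -ri.
    by rewrite xpair_eqE (negbTE xx).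
  move=> n _.
  (* Shifting row (x, y) by [n y] brings its entry [n y] to position 0. *)
  pose f (d : A * B) i := if d.1 == x then i + n d.2 else i.
  have f_incr d : {homo f d : i j / i < j}.
    by move=> i j; rewrite /f; case: ifP => // _; rewrite ltn_add2r.
  pose P' b := P b /\ P2 (fun i => b (inr i)).
  have dP' : definable P' := definable_and dP (definable_comp inr dP2).
  have [b2 Hb2] : exists b2, G s g N P' b2 (fun z => e (relabel f z.1, z.2)).
    apply/(ind f (fun u => exists b2, G s g N P' b2 u) f_incr).
      exact/definable_ex/definable_uniform_in.
    by apply: Hg.
  exists b2; split; first by have [b1 [[_ ?] _]] := Hb2 [ffun=> ord0].
  move=> y h; have [b1 [[Pb _] Hb]] := Hb2 h; exists b1; split=> // x' y' xy'.
  have : sel s g x' y'.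
    move=> x's; rewrite xy' ?in_cons ?x's ?orbT // /gx.
    by case: eqP => // xx; rewrite -xx x's in xs.
  move/Hb; congr (R _ _ _); apply: funext => j; congr (e (_, _)).
  rewrite /relabel /shift /f /= /ix xpair_eqE; case: (eqVneq x' x) => [xx|xx] //=.
  have -> : y' = y by rewrite (xy' _) /gx ?xx ?eqxx // in_cons eqxx.
  by rewrite xx (negbTE xs) !eqxx.
have [g Hg] : C (enum A).
  elim: (enum A) (enum_uniq A) => //= x s IH /andP[xs us].
  by apply: Cstep => //; exact: IH.
apply: (@inp_pattern_of_approx L M K I1 a1 A (I2 + nat)%type
  (fun x b1 w => R (x, g x) (vcat b1 (fun i => w (inl i))) (fun j => w (inr j)))
  (fun x => k (x, g x)) monM).
  move=> x; exact: (definable_rel_vcat inl (fun i => inr (inl i))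
                     (fun j => inr (inr j))).
move=> N P dP Pa.
have [b2 Hb2] := Hg N (fun b => P (fun i => b (inl i))) (definable_comp inl dP) Pa.
exists (fun x n => vcat b2 (fun j => e (x, g x, n, j))); split.
  move=> x s s_inj [b Hb]; apply: (rows (x, g x) s s_inj).
  by exists (vcat b b2).
move=> f fN; have [b1 [Pb Hb]] := Hb2 [ffun x => inord (f x)].
exists b1; split=> // x; have /(_ x (g x)) := Hb; rewrite /ix mem_enum ffunE /= inordK.
  by move=> H; apply: H.
by apply: leqW.
Qed.

(** * Burden and depth *)

Lemma inp_pattern_sub (L : language) (M : structure L) (I D D' : Type)
    (p : set (pform M I)) (f : D' -> D) :
  injective f -> inp_pattern p D -> inhabited (inp_pattern p D').
Proof.
move=> f_inj q; split.
apply: (@Build_inp_pattern L M I p D' (fun d => ysize q (f d))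
          (fun d => @array _ _ _ _ _ q (f d)) (fun d => @fml _ _ _ _ _ q (f d))
          (fun d => knum q (f d))).
  by move=> d; exact: (@row_inconsistent _ _ _ _ _ q (f d)).
move=> h; have /boolp.choice[h' Hh'] d :
    exists n, forall d', f d' = d -> h d' = n.
  have [[d' <-]|N] := EM (exists d', f d' = d).
    by exists (h d') => d'' /f_inj ->.
  by exists 0 => d' fd; case: N; exists d'.
have [N [i [b [Ei Hb]]]] := path_consistent q h'.
exists N, i, b; split=> // psi [[d ->]|ppsi]; apply: Hb; last by right.
by left; exists (f d); rewrite (Hh' (f d) d).
Qed.

Lemma not_card_le_ord (D : Type) (m : nat) :
  ~ ([set: D] #<= [set: 'I_m]) -> exists f : 'I_m.+1 -> D, injective f.
Proof.
move=> nle; suff H j : j <= m.+1 -> exists f : 'I_j -> D, injective f by exact: H.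
elim: j => [_|j IH jm].
  have f0 : 'I_0 -> D by case.
  by exists f0 => -[].
have [f f_inj] := IH (ltnW jm).
have [d Hd] : exists d, forall i, f i <> d.
  apply: contrapT => N; apply: nle.
  have /boolp.choice[g Hg] d : exists i, f i = d.
    by apply: contrapT => Nd; apply: N; exists d => i fi; apply: Nd; exists i.
  apply: (@inj_card_le_setT _ _ (fun d => widen_ord (jm : j <= m) (g d))).
  by move=> x y /(congr1 val) /= /val_inj gxy; rewrite -(Hg x) gxy Hg.
exists (fun i => oapp f d (unlift ord_max i)) => x y.
case: (unliftP ord_max x) => [x' ->|->]; case: (unliftP ord_max y) => [y' ->|->];
  rewrite ?liftK ?unlift_none //=.
- by move/f_inj ->.
- by move/Hd.
- by move/esym/Hd.
Qed.

Lemma no_inp_pattern_of_bdn_lt (L : language) (M : structure L) (I : Type)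
    (p : set (pform M I)) (k : nat) :
  bdn_lt p k -> ~ inhabited (inp_pattern p 'I_k).
Proof. by move=> [B [[ub _] [_ nle]]] pat; apply: nle; exact: ub. Qed.

(** The supremum is attained: it is the largest [m] such that there is an
    inp-pattern of depth [m], because a deeper one restricts to depth [m.+1]. *)
Lemma bdn_lt_of_no_inp_pattern (L : language) (M : structure L) (I : Type)
    (p : set (pform M I)) (k : nat) :
  inhabited (inp_pattern p 'I_0) -> ~ inhabited (inp_pattern p 'I_k) ->
  bdn_lt p k.
Proof.
move=> pat0 nk.
have ex : exists m, `[< ~ inhabited (inp_pattern p 'I_m) >].
  by exists k; apply/asboolP.
case: (ex_minnP ex) => -[|m] /asboolP nm m_min; first by case: nm.
have patm : inhabited (inp_pattern p 'I_m).
  by apply: contrapT => N; have := m_min m (asboolT N); rewrite ltnn.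
have mk : m < k by apply: m_min; apply/asboolP.
exists 'I_m; split; [split|split].
- move=> D [patD]; apply: contrapT => /not_card_le_ord[f f_inj].
  by apply: nm; exact: inp_pattern_sub f_inj patD.
- by move=> B' ub; exact: ub.
- apply: (@inj_card_le_setT _ _ (widen_ord (ltnW mk))) => x y /(congr1 val) xy.
  exact: val_inj.
- move=> /card_le_setT_inj[f /leq_card]; rewrite !card_ord leqNgt.
  by rewrite mk.
Qed.

(** The section [h] makes the [J]-indexed tuple determine the [I]-indexed one,
    so the formulas can be rewritten in the variables [J]. *)
Lemma inp_pattern_reindex (L : language) (M : structure L) (K I J : Type)
    (a : I -> M) (D : finType) (g : J -> I) (h : I -> J) :
  monster M K -> cancel h g -> inp_pattern (tp a set0) D ->
  inhabited (inp_pattern (tp (a \o g) set0) D).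
Proof.
move=> monM hK /pattern_of_inp_pattern[R [k [c [Rdef [rows paths]]]]].
apply: (@inp_pattern_of_approx L M K J _ D nat
  (fun d b y => R d (fun i => b (h i)) y) k monM).
  by move=> d; exact: (definable_rel (fun i => inl (h i)) inr (Rdef d)).
move=> N P dP Pa; exists c; split.
  by move=> d s s_inj [b Hb]; apply: (rows d s s_inj); exists (b \o h).
move=> f _.
have [b [Pb Hb]] := paths f (fun b => P (fun j => b (g j))) (definable_comp g dP) Pa.
exists (b \o g); split=> // d.
by rewrite (_ : (fun i => _) = b) //; apply: funext => i /=; rewrite hK.
Qed.

(** For [n = 0] the variable tuple is empty, so the formulas are true or
    false: those of a row cannot be individually consistent and jointly
    inconsistent. *)
Lemma no_inp_pattern_concat (L : language) (M : structure L) (K : Type)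
    (n : nat) (I : 'I_n -> Type) (a : forall i : 'I_n, I i -> M)
    (k : 'I_n -> nat) :
  monster M K ->
  (forall i, ~ inhabited (inp_pattern (tp (a i) set0) 'I_(k i))) ->
  ~ inhabited (inp_pattern (tp (concat a) set0) 'I_(\prod_(i < n) k i)).
Proof.
move=> monM; elim: n I a k => [|n IH] I a k nk [p].
  move: p; rewrite big_ord0.
  move=> /pattern_of_inp_pattern[R [kd [c [_ [rows paths]]]]].
  have path j := paths (fun=> j) _ (definable_true M _) Logic.I.
  have [b _] := path 0.
  apply: (rows ord0 (fun j => val j)) => [|]; first exact: val_inj.
  exists b => j; have [b' [_ Hb']] := path (val j).
  by rewrite (_ : b = b') //; apply: funext => -[[]].
pose g (z : I ord0 + {i : 'I_n & I (lift ord0 i)}) : {i : 'I_n.+1 & I i} :=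
  match z with
  | inl x => existT I ord0 x
  | inr z => existT I (lift ord0 (projT1 z)) (projT2 z) end.
have /boolp.choice[h hK] z : exists w, g w = z.
  case: z => i; case: (unliftP ord0 i) => [j ->|->] x.
    by exists (inr (existT _ j x)).
  by exists (inl x).
pose m := \prod_(i < n) k (lift ord0 i).
have E : #|{: 'I_(k ord0) * 'I_m}| = \prod_(i < n.+1) k i.
  by rewrite card_prod !card_ord big_ord_recl.
have [q] := inp_pattern_sub (f := fun z => cast_ord E (enum_rank z))
              (fun x y xy => enum_rank_inj (cast_ord_inj xy)) p.
have [r] := inp_pattern_reindex monM hK q.
have ag : concat a \o g = vcat (a ord0) (concat (fun i => a (lift ord0 i))).
  by apply: funext => -[x|[i x]].
rewrite ag in r; apply: (nk ord0); apply: (inp_pattern_product monM r).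
by apply: IH => i; exact: nk.
Qed.

Theorem corollary2p6 (L : language) (T : set (sentence L))
    (hT : complete_theory T)
    (M : structure L) (hMT : models M T) (K : Type) (hM : monster M K)
    (n : nat) (I : 'I_n -> Type) (hI : forall i, card_lt (I i) K)
    (a : forall i : 'I_n, I i -> M) (k : 'I_n -> nat) :
  (forall i : 'I_n, bdn_lt (tp (a i) set0) (k i)) ->
  bdn_lt (tp (concat a) set0) (\prod_(i < n) k i).
Proof.
move=> H; apply: bdn_lt_of_no_inp_pattern.
  by apply: (inp_pattern_empty _ hM) => -[].
apply: no_inp_pattern_concat hM _ => i; exact/no_inp_pattern_of_bdn_lt/H.
Qed.
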